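(* Let $N\ge2$. For any $a=(a_1,\dots,a_N)\in\mathbb R_+^N$ there is a constant $C$ depending only on $a$ and $N$ such that for all $\alpha,\beta,\gamma\in\{1,-1\}$, all $M>0$ and all $k,l,m\in\widetilde{\mathbb Z}^N_a\setminus\{0\}$ with $|k|,|l|,|m|\le M$ and $k+l=m$, $$\alpha\,\mathrm{sg}(k)|k|+\beta\,\mathrm{sg}(l)|l|-\gamma\,\mathrm{sg}(m)|m|\ne0\ \Longrightarrow\ \frac1{\big|\alpha\,\mathrm{sg}(k)|k|+\beta\,\mathrm{sg}(l)|l|-\gamma\,\mathrm{sg}(m)|m|\big|}\le C(1+M)^5 .$$
   Context: $\widetilde{\mathbb Z}^N_a=\{(n_1/a_1,\dots,n_N/a_N):n_1,\dots,n_N\in\mathbb Z\}\subset\mathbb R^N$, $|\cdot|$ is the Euclidean norm, and for $k\in\mathbb R^N\setminus\{0\}$, $\mathrm{sg}(k)=1$ if the first nonzero component of $k$ is positive and $\mathrm{sg}(k)=-1$ otherwise. *)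

(* Defs.v *)
From mathcomp Require Import all_boot all_order all_algebra.
From mathcomp Require Import reals.

Set Implicit Arguments.
Unset Strict Implicit.
Unset Printing Implicit Defensive.

Import Order.TTheory GRing.Theory Num.Theory.
Local Open Scope ring_scope.

(* The norm that MathComp-Analysis puts on row vectors is the sup norm, so the
   Euclidean norm is defined separately. *)
Definition enorm (R : realType) (N : nat) (x : 'rV[R]_N) : R :=
  Num.sqrt (\sum_(i < N) x 0 i ^+ 2).

Definition scaled_lattice (R : realType) (N : nat) (a x : 'rV[R]_N) : Prop :=
  exists n : 'rV[int]_N, x = \row_(i < N) ((n 0 i)%:~R / a 0 i).

(* Only meaningful for k != 0; the junk value at 0 is -1. *)
Definition sg (R : realType) (N : nat) (k : 'rV[R]_N) : R :=
  if [exists i : 'I_N, (0 < k 0 i) && [forall j : 'I_N, (j < i)%N ==> (k 0 j == 0)]]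
  then 1 else -1.

(* Main.v *)
Require Import Defs.
From mathcomp Require Import all_boot all_order all_algebra.
From mathcomp Require Import reals.
From mathcomp Require Import ring lra.

Set Implicit Arguments.
Unset Strict Implicit.
Unset Printing Implicit Defensive.

Import Order.TTheory GRing.Theory Num.Theory.
Local Open Scope ring_scope.

(** Write [K], [L], [P] for the lengths of [k], [l], [m = k + l], and let
    [d = x + y + z] with [x = +-K], [y = +-L], [z = +-P].  Multiplying [d] by
    its three sign conjugates removes the square roots and, as in Heron's
    formula, leaves sixteen times the squared area of the triangle with sides
    [k], [l], [m]:

      (x + y + z) (x + y - z) (x - y + z) (- x + y + z)
        = 4 (K^2 L^2 - <k, l>^2) = 2 \sum_(i, j) (k_i l_j - k_j l_i)^2.

    The reals [a_i] are arbitrary, so [K^2], [L^2], [P^2] take no discrete set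
    of values; the minors do, because [k_i l_j - k_j l_i] is an integer divided
    by [a_i a_j].

    - If some minor is nonzero, the product is bounded below in terms of [a]
      alone, while each conjugate is at most [3 M].  Hence [1 / |d|] is
      [O(M^3)] ([inv_signed_sum_of_minor]).
    - If all minors vanish, [k], [l], [m] are collinear.  For an index [i] with
      [k_i != 0], the lengths are [|k_i|], [|l_i|], [|m_i|] times the common
      ratio [K / |k_i| >= 1], so [d] is this ratio times a nonzero integer over
      [a_i], and [1 / |d| <= a_i] ([inv_signed_sum_of_collinear]).

    The argument is uniform in the signs, because squaring removes them in the
    first case and they are integers in the second. *)

(** * Signs *)

Lemma sg_sign {R : realType} {N : nat} (x : 'rV[R]_N) : sg x \in [:: 1; -1].
Proof. by rewrite /sg; case: ifP; rewrite !inE eqxx ?orbT. Qed.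

Lemma signM {R : realType} (s t : R) :
  s \in [:: 1; -1] -> t \in [:: 1; -1] -> s * t \in [:: 1; -1].
Proof.
rewrite !inE => /orP[]/eqP-> /orP[]/eqP->;
  by rewrite ?mulrNN ?mulr1 ?mul1r ?eqxx ?orbT.
Qed.

Lemma normr_signM {R : realType} (s x : R) :
  s \in [:: 1; -1] -> `|s * x| = `|x|.
Proof. by rewrite !inE => /orP[]/eqP->; rewrite ?mul1r ?mulN1r ?normrN. Qed.

Lemma sign_int {R : realType} (s : R) : s \in [:: 1; -1] -> s \is a Num.int.
Proof. by rewrite !inE => /orP[] /eqP ->; rewrite ?rpredN rpred1. Qed.

(** * The Euclidean norm *)

Section EuclideanNorm.
Context {R : realType} {N : nat}.
Implicit Types x y : 'rV[R]_N.

Lemma enorm_ge0 x : 0 <= enorm x.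
Proof. exact: sqrtr_ge0. Qed.

Lemma sqr_enorm x : enorm x ^+ 2 = \sum_i x 0 i ^+ 2.
Proof. by rewrite sqr_sqrtr // sumr_ge0 // => i _; rewrite sqr_ge0. Qed.

Lemma enormZ c x : enorm (c *: x) = `|c| * enorm x.
Proof.
rewrite /enorm -sqrtr_sqr -sqrtrM ?sqr_ge0 // mulr_sumr.
by congr Num.sqrt; apply: eq_bigr => i _; rewrite mxE exprMn.
Qed.

Lemma ler_coord_enorm x i : `|x 0 i| <= enorm x.
Proof.
rewrite -sqrtr_sqr ler_wsqrtr // (bigD1 i) //= lerDl sumr_ge0 // => j _.
exact: sqr_ge0.
Qed.

Lemma sqr_enormD x y :
  enorm (x + y) ^+ 2
    = enorm x ^+ 2 + enorm y ^+ 2 + 2 * \sum_i x 0 i * y 0 i.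
Proof.
rewrite !sqr_enorm mulr_sumr -!big_split /=.
by apply: eq_bigr => i _; rewrite mxE; ring.
Qed.

(** Lagrange's identity; the sum runs over ordered pairs, so every minor is
    counted twice. *)
Lemma lagrange_identity x y :
  2 * (enorm x ^+ 2 * enorm y ^+ 2 - (\sum_i x 0 i * y 0 i) ^+ 2)
    = \sum_i \sum_j (x 0 i * y 0 j - x 0 j * y 0 i) ^+ 2.
Proof.
have minorE : \sum_i \sum_j (x 0 i * y 0 j - x 0 j * y 0 i) ^+ 2
    = \sum_i \sum_j (x 0 i ^+ 2 * y 0 j ^+ 2)
      + \sum_i \sum_j (y 0 i ^+ 2 * x 0 j ^+ 2)
      - 2 * \sum_i \sum_j ((x 0 i * y 0 i) * (x 0 j * y 0 j)).
  rewrite mulr_sumr -sumrN -!big_split /=; apply: eq_bigr => i _.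
  rewrite mulr_sumr -sumrN -!big_split /=; apply: eq_bigr => j _.
  by ring.
by rewrite minorE -!big_distrlr /= !sqr_enorm; ring.
Qed.

(** Heron's formula.  Signs may be hidden in [x], [y], [z], of which only the
    squares are prescribed. *)
Lemma heron_minors (k l : 'rV[R]_N) (x y z : R) :
    x ^+ 2 = enorm k ^+ 2 -> y ^+ 2 = enorm l ^+ 2 ->
    z ^+ 2 = enorm (k + l) ^+ 2 ->
  (x + y + z) * ((x + y - z) * (x - y + z) * (- x + y + z))
    = 2 * \sum_i \sum_j (k 0 i * l 0 j - k 0 j * l 0 i) ^+ 2.
Proof.
move=> hx hy hz; rewrite -lagrange_identity.
have -> : (x + y + z) * ((x + y - z) * (x - y + z) * (- x + y + z))
    = 4 * (x ^+ 2 * y ^+ 2) - (x ^+ 2 + y ^+ 2 - z ^+ 2) ^+ 2 by ring.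
by rewrite hz sqr_enormD hx hy; ring.
Qed.

End EuclideanNorm.

(** * Lower bounds for the signed sum of lengths *)

Section SignedSum.
Context {R : realType} {N : nat}.
Variable a : 'rV[R]_N.
Hypothesis a_gt0 : forall i, 0 < a 0 i.

Lemma ler_coord_sum i : a 0 i <= \sum_j a 0 j.
Proof.
by rewrite (bigD1 i) //= lerDl sumr_ge0 // => j _; rewrite ltW.
Qed.

(** Such a minor is a nonzero integer over [a_i a_j].  Replacing [a_i] and [a_j]
    by the sum of all [a_i] makes the bound independent of the indices. *)
Lemma minor_lattice_ge (k l : 'rV[R]_N) i j :
    scaled_lattice a k -> scaled_lattice a l ->
    k 0 i * l 0 j - k 0 j * l 0 i != 0 ->
  1 <= (\sum_i a 0 i) ^+ 2 * `|k 0 i * l 0 j - k 0 j * l 0 i|.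
Proof.
move=> [p ->] [q ->]; rewrite !mxE.
have ai := a_gt0 i; have aj := a_gt0 j.
have -> : (p 0 i)%:~R / a 0 i * ((q 0 j)%:~R / a 0 j)
          - (p 0 j)%:~R / a 0 j * ((q 0 i)%:~R / a 0 i)
        = (p 0 i * q 0 j - p 0 j * q 0 i)%:~R / (a 0 i * a 0 j) :> R.
  by rewrite rmorphB !rmorphM /=; field; rewrite !gt_eqF.
set n := (_ - _ : int) => mn0.
have n1 : 1 <= `|n%:~R : R|.
  rewrite norm_intr_ge1 ?intr_int //.
  by apply: contraNneq mn0 => ->; rewrite mul0r.
have aij : 0 < a 0 i * a 0 j by rewrite mulr_gt0.
rewrite normrM normfV (gtr0_norm aij) mulrCA.
apply: le_trans n1 _; rewrite ler_peMr // ler_pdivlMr // mul1r expr2.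
by rewrite ler_pM ?ler_coord_sum ?ltW.
Qed.

(** Let [A] be the sum of the [a_i].  Heron's product is at least [2 / A^4] by
    the minor bound, and in absolute value at most
    [27 M^3] times the signed sum, so [27 / 2 <= 14] is a valid constant. *)
Lemma inv_signed_sum_of_minor (k l : 'rV[R]_N) (x y z M : R) i j :
    scaled_lattice a k -> scaled_lattice a l ->
    `|x| = enorm k -> `|y| = enorm l -> `|z| = enorm (k + l) ->
    enorm k <= M -> enorm l <= M -> enorm (k + l) <= M ->
    k 0 i * l 0 j - k 0 j * l 0 i != 0 -> x + y + z != 0 ->
  1 / `|x + y + z| <= 14 * (\sum_i a 0 i) ^+ 4 * M ^+ 3.
Proof.
move=> hk hl hx hy hz; rewrite -hx -hy -hz => xM yM zM mn0 d0.
have xyzE := heron_minors (x := x) (y := y) (z := z) (k := k) (l := l).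
rewrite -hx -hy -hz !(real_normK (num_real _)) in xyzE.
have {}xyzE := xyzE erefl erefl erefl.
have minor1 := minor_lattice_ge hk hl mn0.
move: xyzE minor1.
set A := \sum_i a 0 i; set mu := k 0 i * _ - _.
set T := (\sum_i \sum_j _).
move=> xyzE minor1.
have muT : mu ^+ 2 <= T.
  rewrite /T (bigD1 i) //= (bigD1 j) //= -addrA lerDl.
  by rewrite addr_ge0 ?sumr_ge0 // => i' _; rewrite ?sumr_ge0 // => *;
     rewrite sqr_ge0.
have AT : 1 <= A ^+ 4 * T.
  apply: le_trans (_ : A ^+ 4 * mu ^+ 2 <= _); last first.
    by rewrite ler_wpM2l // -[4%N]/(2 * 2)%N exprM sqr_ge0.
  rewrite -(real_normK (num_real mu)) -[4%N]/(2 * 2)%N exprM -exprMn.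
  by rewrite exprn_ege1.
have d_gt0 : 0 < `|x + y + z| by rewrite normr_gt0.
(* Each sign conjugate is a sum of three terms of absolute value at most M. *)
have conj3 : `|(x + y - z) * (x - y + z) * (- x + y + z)| <= 27 * M ^+ 3.
  have -> : 27 * M ^+ 3 = (3 * M) * (3 * M) * (3 * M) by ring.
  rewrite !normrM; move: xM yM zM.
  rewrite ![`|_| <= M]ler_norml => /andP[? ?] /andP[? ?] /andP[? ?].
  by rewrite !ler_pM ?mulr_ge0 // ler_norml; apply/andP; split; lra.
have dT : 2 * T <= `|x + y + z| * (27 * M ^+ 3).
  by rewrite -xyzE (le_trans (ler_norm _)) // normrM ler_wpM2l.
have A4 : 0 <= A ^+ 4 by rewrite -[4%N]/(2 * 2)%N exprM sqr_ge0.
have M3 : 0 <= M ^+ 3 by rewrite exprn_ge0 // (le_trans _ xM).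
rewrite ler_pdivrMr //.
have ? : 2 * (A ^+ 4 * T) <= A ^+ 4 * (`|x + y + z| * (27 * M ^+ 3)).
  by rewrite mulrCA ler_wpM2l.
have ? : 0 <= A ^+ 4 * M ^+ 3 * `|x + y + z|.
  exact: mulr_ge0 (mulr_ge0 A4 M3) (normr_ge0 _).
lra.
Qed.

(** Both sides are the norm of the vector [k_i x = x_i k]. *)
Lemma enorm_collinear (k x : 'rV[R]_N) i :
    (forall j, k 0 i * x 0 j = k 0 j * x 0 i) ->
  `|k 0 i| * enorm x = `|x 0 i| * enorm k.
Proof.
move=> kx; rewrite -!enormZ; congr enorm.
by apply/rowP => j; rewrite !mxE kx mulrC.
Qed.

(** The common ratio of lengths to [i]-th coordinates factors out of the signed
    sum and leaves a one-dimensional sum, which takes discrete values. *)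
Lemma inv_signed_sum_of_collinear (k l : 'rV[R]_N) (s t u : R) :
    scaled_lattice a k -> scaled_lattice a l -> k != 0 ->
    s \in [:: 1; -1] -> t \in [:: 1; -1] -> u \in [:: 1; -1] ->
    (forall i j, k 0 i * l 0 j = k 0 j * l 0 i) ->
    s * enorm k + t * enorm l + u * enorm (k + l) != 0 ->
  1 / `|s * enorm k + t * enorm l + u * enorm (k + l)| <= \sum_i a 0 i.
Proof.
move=> hk hl /rV0Pn[i ki0] hs ht hu kl d0.
have Lk := enorm_collinear (kl i).
have Pk : `|k 0 i| * enorm (k + l) = `|(k + l) 0 i| * enorm k.
  by apply: enorm_collinear => j; rewrite !mxE !mulrDr kl (mulrC (k 0 i)).
have {d0} := d0; set d := (_ + _ + _) => d0.
(* The signed sum of the [i]-th coordinates: up to the factor [a_i] it is a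
   nonzero integer, and it is [d] divided by the ratio [K / |k_i|]. *)
set e := s * `|k 0 i| + t * `|l 0 i| + u * `|(k + l) 0 i|.
have de : `|k 0 i| * d = enorm k * e.
  by rewrite /d /e !mulrDr !(mulrCA `|k 0 i|) Lk Pk; ring.
have ai := a_gt0 i; have ai0 : a 0 i != 0 by rewrite gt_eqF.
have ea : a 0 i * e \is a Num.int.
  case: hk hl => [p kE] [q lE].
  have aki : a 0 i * `|k 0 i| = `|(p 0 i)%:~R|.
    by rewrite kE mxE normrM normfV (gtr0_norm ai) mulrC mulfVK.
  have ali : a 0 i * `|l 0 i| = `|(q 0 i)%:~R|.
    by rewrite lE mxE normrM normfV (gtr0_norm ai) mulrC mulfVK.
  have ami : a 0 i * `|(k + l) 0 i| = `|(p 0 i + q 0 i)%:~R|.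
    by rewrite kE lE !mxE -mulrDl -rmorphD normrM normfV (gtr0_norm ai) mulrC
               mulfVK.
  rewrite /e !mulrDr !(mulrCA (a 0 i)) aki ali ami -!intr_norm.
  by rewrite !rpredD // rpredM ?intr_int ?sign_int.
have ki : 0 < `|k 0 i| by rewrite normr_gt0.
have e0 : e != 0.
  apply: contraNneq d0 => e0; move/eqP: de; rewrite e0 mulr0 mulf_eq0.
  by rewrite gt_eqF.
have ae1 : 1 <= a 0 i * `|e|.
  by rewrite -{1}(gtr0_norm ai) -normrM norm_intr_ge1 // mulf_neq0.
have ed : `|e| <= `|d|.
  have -> : `|d| = (enorm k * `|e|) / `|k 0 i|.
    apply: (canRL (mulfK _)); first by rewrite gt_eqF.
    by rewrite mulrC -normr_id -normrM de normrM ger0_norm ?enorm_ge0.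
  by rewrite ler_pdivlMr // mulrC ler_wpM2r ?ler_coord_enorm.
rewrite ler_pdivrMr ?normr_gt0 //; apply: le_trans ae1 _.
by rewrite ler_pM ?ler_coord_sum // ltW.
Qed.

End SignedSum.

(** * The main estimate *)

Theorem proposition5p2 (R : realType) (N : nat) (hN : (2 <= N)%N)
    (a : 'rV[R]_N) (ha : forall i : 'I_N, 0 < a 0 i) :
  exists C : R,
    forall alpha beta gamma : R,
      alpha \in [:: 1; -1] -> beta \in [:: 1; -1] -> gamma \in [:: 1; -1] ->
    forall M : R, 0 < M ->
    forall k l m : 'rV[R]_N,
      scaled_lattice a k -> scaled_lattice a l -> scaled_lattice a m ->
      k != 0 -> l != 0 -> m != 0 ->
      enorm k <= M -> enorm l <= M -> enorm m <= M ->
      k + l = m ->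
      alpha * sg k * enorm k + beta * sg l * enorm l - gamma * sg m * enorm m != 0 ->
      1 / `|alpha * sg k * enorm k + beta * sg l * enorm l - gamma * sg m * enorm m|
        <= C * (1 + M) ^+ 5.
Proof.
set A := \sum_i a 0 i; exists (14 * A ^+ 4 + A).
move=> al be ga hal hbe hga M M0 k l m hk hl _ k0 _ _ kM lM mM klm.
rewrite -{m}klm in mM *; rewrite -mulNr.
have hs := signM hal (sg_sign k); have ht := signM hbe (sg_sign l).
have hu : - (ga * sg (k + l)) \in [:: 1; -1].
  rewrite -[X in X \in _]mulN1r; apply: signM (signM hga (sg_sign _)).
  by rewrite !inE eqxx orbT.
move: (al * sg k) (be * sg l) (- (ga * sg (k + l))) hs ht hu => s t u hs ht hu.
move=> d0.
have A0 : 0 <= A by apply: sumr_ge0 => i _; rewrite ltW.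
have A4 : 0 <= 14 * A ^+ 4 by rewrite mulr_ge0 ?exprn_ge0.
have M1 : 1 <= 1 + M by rewrite lerDl ltW.
rewrite mulrDl.
case: (boolP [forall i, forall j, k 0 i * l 0 j == k 0 j * l 0 i]) => [kl|].
  have {}kl i j : k 0 i * l 0 j = k 0 j * l 0 i.
    by move/forallP/(_ i)/forallP/(_ j)/eqP: kl.
  apply: le_trans (inv_signed_sum_of_collinear ha hk hl k0 hs ht hu kl d0) _.
  by rewrite ler_wpDl ?ler_peMr ?exprn_ege1 // mulr_ge0 // exprn_ge0 ?addr_ge0
             // ltW.
case/forallPn => i /forallPn[j]; rewrite -subr_eq0 => mn0.
have abs_enorm (x : 'rV[R]_N) v : v \in [:: 1; -1] -> `|v * enorm x| = enorm x.
  by move=> hv; rewrite normr_signM // ger0_norm // enorm_ge0.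
apply: le_trans (inv_signed_sum_of_minor ha hk hl (abs_enorm k s hs)
  (abs_enorm l t ht) (abs_enorm _ u hu) kM lM mM mn0 d0) _.
have M35 : M ^+ 3 <= (1 + M) ^+ 5.
  apply: le_trans (_ : (1 + M) ^+ 3 <= _); last by rewrite ler_weXn2l.
  by rewrite lerXn2r ?nnegrE ?addr_ge0 ?lerDr ?ltW.
rewrite ler_wpDr ?ler_wpM2l // mulr_ge0 // exprn_ge0 // (le_trans _ M1) //.
Qed.
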